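(* Let $\mathbf{s}^*(p)$, $p\in\mathcal{X}_{feas}$, be the solution manifold of the parametric nonlinear program $\mathcal{P}(p)$, and let $\hat{\mathbf{s}}(p)$ be the piecewise linear inexact manifold obtained around the exact solutions $\mathbf{s}^*(p_i)$, $i=1,\dots,N_s$, by means of the tangential predictor, where the sizes $\|\Delta p_i\|$ of the regions around the $p_i$ are chosen such that the active constraint set remains the same on each region and such that $\hat{\mathbf{s}}(p)$ exists for all $p\in\mathcal{X}_{feas}$. Let $\pi(p;\theta)$ be a parametric function with sufficiently rich parametrization: there exist parameters $\theta^*$ and $\hat\theta$ such that $\mathbf{s}^*(p)=\pi(p;\theta^* )$ and $\hat{\mathbf{s}}(p)=\pi(p;\hat\theta)$ for all $p\in\mathcal{X}_{feas}$. For $M$ samples, let $$\theta_2=\arg\min_\theta\sum_{k=1}^{M}\|\pi(p_k;\theta)-\hat{\mathbf{s}}(p_k)\|^2,$$ and suppose that $\theta_2$ is a consistent estimator (of $\hat\theta$). Then, for every $p\in\mathcal{X}_{feas}$, $$\|\pi_{\mathrm{mpc}}(p)-\pi(p;\theta_2)\|\le D\quad\text{in probability as } M\to\infty,$$ where $D:=\max\left(\left\{L_{p_i}\|\Delta p_i\|^2\right\}_{i=1}^{N_s}\right)$.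
   Context: Parametric NLP: for a parameter $p\in\mathbb{R}^{n_x}$ (the initial state of a model predictive control problem), $\mathcal{P}(p)$ is the problem $V_N(p)=\min_{\mathbf{w}} J(\mathbf{w},p)$ subject to $c(\mathbf{w},p)=0$, $g(\mathbf{w},p)\le 0$. Its Lagrangian is $\mathcal{L}(\mathbf{w},p,\lambda,\mu)=J(\mathbf{w},p)+\lambda^{\mathsf T}c(\mathbf{w},p)+\mu^{\mathsf T}g(\mathbf{w},p)$. A KKT point for $p$ is a primal-dual vector $\mathbf{s}^*(p)=[\mathbf{w}^*,\lambda^*,\mu^*]^{\mathsf T}$ with $\nabla_{\mathbf{w}}\mathcal{L}=0$, $c=0$, $g\le 0$, $\mu_j g_j=0$ and $\mu_j\ge 0$ for all $j$. The active inequality constraints $g_{\mathbb{A}}$ are the components of $g$ equal to $0$ at the solution. $\mathcal{X}_{feas}\subseteq\mathbb{R}^{n_x}$ is the feasible set of parameters (initial states), and $p\mapsto\mathbf{s}^*(p)$ denotes the optimal primal-dual solution of $\mathcal{P}(p)$ for $p\in\mathcal{X}_{feas}$ (the solution manifold). Since solving the MPC problem online gives exactly this solution, the MPC policy is identified here with the true solution manifold: $\pi_{\mathrm{mpc}}(p)=\mathbf{s}^*(p)$. Standing regularity: at each base point $p_i\in\mathcal{X}_{feas}$, $i=1,\dots,N_s$, the functions $J,c,g$ are twice continuously differentiable in a neighborhood of the KKT point $\mathbf{s}^*(p_i)$, and the linear independence constraint qualification (LICQ), the second order sufficient conditions (SOSC) and strict complementarity (SC: multipliers of active inequality constraints are $>0$)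 hold at $\mathbf{s}^*(p_i)$. Tangential predictor: at $p_i$ set $$\mathcal{M}_i=\begin{bmatrix}\nabla^2_{\mathbf{w}\mathbf{w}}\mathcal{L}&\nabla_{\mathbf{w}}c&\nabla_{\mathbf{w}}g_{\mathbb{A}}\\ \nabla_{\mathbf{w}}c^{\mathsf T}&0&0\\ \nabla_{\mathbf{w}}g_{\mathbb{A}}^{\mathsf T}&0&0\end{bmatrix},\qquad \mathcal{N}_i=\begin{bmatrix}\nabla^2_{\mathbf{w}p}\mathcal{L}\\ \nabla_p c^{\mathsf T}\\ \nabla_p g_{\mathbb{A}}^{\mathsf T}\end{bmatrix},$$ evaluated at $\mathbf{s}^*(p_i)$ and $p_i$. The predictor is $\hat{\mathbf{s}}^*(p_i+\Delta p)=\mathbf{s}^*(p_i)-\mathcal{M}_i^{-1}\mathcal{N}_i\Delta p$ (multipliers of inactive constraints are kept equal to $0$). Piecewise linear inexact manifold: around each $p_i$ one takes a region $R_i\subseteq\mathcal{X}_{feas}$ containing $p_i$. The size $\|\Delta p_i\|>0$ of $R_i$ is the maximal norm of the perturbations allowed around $p_i$, so that $\|p-p_i\|\le\|\Delta p_i\|$ for $p\in R_i$. The regions $R_1,\dots,R_{N_s}$ cover $\mathcal{X}_{feas}$, each $p\in\mathcal{X}_{feas}$ being assigned to one region. The active constraint set at $\mathbf{s}^*(p)$ is the same for all $p\in R_i$. For $p$ assigned to $R_i$, $\hat{\mathbf{s}}(p)=\mathbf{s}^*(p_i)-\mathcal{M}_i^{-1}\mathcal{N}_i(p-p_i)$. The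 $L_{p_i}$ are positive constants for which the bound $\|\hat{\mathbf{s}}(p)-\mathbf{s}^*(p)\|\le\max(\{L_{p_i}\|\Delta p_i\|^2\}_{i=1}^{N_s})$ holds for all $p\in\mathcal{X}_{feas}$. Estimation: $M=N_sN_p$ training points $p_k\in\mathcal{X}_{feas}$, $k=1,\dots,M$, are sampled (randomly); $N_s$ and the manifold $\hat{\mathbf{s}}$ are fixed while $M\to\infty$. Thus $\theta_2=\theta_2^{(M)}$ is random and depends on $M$. Consistency, as the paper writes it, means $\lim_{M\to\infty}\mathbb{P}(|\theta_2-\hat\theta|>\epsilon)=0$ for any $\epsilon\ge 0$. A bound $\|X_M\|\le D$ ''in probability as $M\to\infty$'' means $\lim_{M\to\infty}\mathbb{P}(\|X_M\|>D)=0$. *)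

(* Defs.v *)
From HB Require Import structures.
From mathcomp Require Import all_boot all_order all_algebra.
From mathcomp Require Import all_classical all_reals all_analysis.
Set Implicit Arguments.
Unset Strict Implicit.
Unset Printing Implicit Defensive.
Import Order.TTheory GRing.Theory Num.Theory.
Import numFieldNormedType.Exports.
Local Open Scope classical_set_scope.
Local Open Scope ring_scope.

(* The library norm on matrices is the max norm; all norms of vectors below
   are Euclidean. *)
Definition enorm (R : realType) (n : nat) (x : 'cV[R]_n) : R :=
  Num.sqrt (\sum_(i < n) x i 0 ^+ 2).

Definition partial (R : realType) (n : nat) (f : 'cV[R]_n -> R) (j : 'I_n)
    (x : 'cV[R]_n) : R :=
  'D_(delta_mx j 0) (f : 'cV[R]_n -> R^o) x.

Definition gradient (R : realType) (n : nat) (f : 'cV[R]_n -> R)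
    (x : 'cV[R]_n) : 'cV[R]_n :=
  \col_j partial f j x.

Definition C1_near (R : realType) (n : nat) (f : 'cV[R]_n -> R)
    (x0 : 'cV[R]_n) : Prop :=
  \forall x \near x0, forall j : 'I_n,
    derivable (f : 'cV[R]_n -> R^o) x (delta_mx j 0) /\
    {for x, continuous (partial f j : 'cV[R]_n -> R^o)}.

Definition C2_near (R : realType) (n : nat) (f : 'cV[R]_n -> R)
    (x0 : 'cV[R]_n) : Prop :=
  C1_near f x0 /\ forall j : 'I_n, C1_near (partial f j) x0.

(* Minimise cost w p over w subject to eqc w p = 0 and ineqc w p <= 0. *)
Record pnlp (R : realType) (nw nx nc ng : nat) := PNLP {
  cost : 'cV[R]_nw -> 'cV[R]_nx -> R;
  eqc : 'cV[R]_nw -> 'cV[R]_nx -> 'cV[R]_nc;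
  ineqc : 'cV[R]_nw -> 'cV[R]_nx -> 'cV[R]_ng }.

(* A primal-dual vector stacks w, lambda and mu, in this order. *)
Definition primal (R : realType) (nw nc ng : nat)
  (s : 'cV[R]_(nw + (nc + ng))) : 'cV[R]_nw := usubmx s.
Definition eqmult (R : realType) (nw nc ng : nat)
  (s : 'cV[R]_(nw + (nc + ng))) : 'cV[R]_nc := usubmx (dsubmx s).
Definition ineqmult (R : realType) (nw nc ng : nat)
  (s : 'cV[R]_(nw + (nc + ng))) : 'cV[R]_ng := dsubmx (dsubmx s).

Section ParametricNLP.
Variables (R : realType) (nw nx nc ng : nat) (P : pnlp R nw nx nc ng).
Implicit Types (w : 'cV[R]_nw) (p : 'cV[R]_nx) (s : 'cV[R]_(nw + (nc + ng))).

Definition feasible w p : Prop :=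
  eqc P w p = 0 /\ forall j : 'I_ng, ineqc P w p j 0 <= 0.

Definition feasible_params : set 'cV[R]_nx := [set p | exists w, feasible w p].

Definition is_minimizer w p : Prop :=
  feasible w p /\ forall w', feasible w' p -> cost P w p <= cost P w' p.

Definition lagrangian w p (lam : 'cV[R]_nc) (mu : 'cV[R]_ng) : R :=
  cost P w p + \sum_(i < nc) lam i 0 * eqc P w p i 0
             + \sum_(j < ng) mu j 0 * ineqc P w p j 0.

(* The directional derivative is a total function, so that the existence of
   the gradient of the Lagrangian has to be required separately. *)
Definition kkt_point s p : Prop :=
  let L w := lagrangian w p (eqmult s) (ineqmult s) in
  [/\ differentiable (L : 'cV[R]_nw -> R^o) (primal s)
        /\ gradient L (primal s) = 0,
      eqc P (primal s) p = 0,
      forall j : 'I_ng, ineqc P (primal s) p j 0 <= 0,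
      forall j : 'I_ng, ineqmult s j 0 * ineqc P (primal s) p j 0 = 0
    & forall j : 'I_ng, 0 <= ineqmult s j 0].

Definition optimal_solution s p : Prop :=
  is_minimizer (primal s) p /\ kkt_point s p.

Definition active w p : {set 'I_ng} := [set j | ineqc P w p j 0 == 0].

(* Column j is the gradient of the j-th constraint. *)
Definition grad_w_eqc w p : 'M[R]_(nw, nc) :=
  \matrix_(i, j) gradient (fun w' => eqc P w' p j 0) w i 0.
Definition grad_p_eqc w p : 'M[R]_(nx, nc) :=
  \matrix_(i, j) gradient (fun p' => eqc P w p' j 0) p i 0.
Definition grad_w_ineqc w p : 'M[R]_(nw, ng) :=
  \matrix_(i, j) gradient (fun w' => ineqc P w' p j 0) w i 0.
Definition grad_p_ineqc w p : 'M[R]_(nx, ng) :=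
  \matrix_(i, j) gradient (fun p' => ineqc P w p' j 0) p i 0.

Definition grad_w_act w p : 'M[R]_(nw, #|active w p|) :=
  colsub (@enum_val _ (mem (active w p))) (grad_w_ineqc w p).
Definition grad_p_act w p : 'M[R]_(nx, #|active w p|) :=
  colsub (@enum_val _ (mem (active w p))) (grad_p_ineqc w p).

Definition hess_ww s p : 'M[R]_nw :=
  \matrix_(i, j)
    partial (fun w => partial
      (fun w' => lagrangian w' p (eqmult s) (ineqmult s)) i w) j (primal s).
Definition hess_wp s p : 'M[R]_(nw, nx) :=
  \matrix_(i, j)
    partial (fun p' => partial
      (fun w' => lagrangian w' p' (eqmult s) (ineqmult s)) i (primal s)) j p.

(* C^2 jointly in (w, p), on a neighborhood of (w0, p0). *)
Definition C2_data w0 p0 : Prop :=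
  [/\ C2_near (fun z : 'cV[R]_(nw + nx) => cost P (usubmx z) (dsubmx z))
        (col_mx w0 p0),
      forall i : 'I_nc,
        C2_near (fun z : 'cV[R]_(nw + nx) => eqc P (usubmx z) (dsubmx z) i 0)
          (col_mx w0 p0)
    & forall j : 'I_ng,
        C2_near (fun z : 'cV[R]_(nw + nx) => ineqc P (usubmx z) (dsubmx z) j 0)
          (col_mx w0 p0)].

Definition LICQ s p : Prop :=
  row_free (row_mx (grad_w_eqc (primal s) p) (grad_w_act (primal s) p))^T.

Definition critical_direction s p (d : 'cV[R]_nw) : Prop :=
  [/\ (grad_w_eqc (primal s) p)^T *m d = 0,
      forall j, j \in active (primal s) p -> 0 < ineqmult s j 0 ->
        ((grad_w_ineqc (primal s) p)^T *m d) j 0 = 0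
    & forall j, j \in active (primal s) p -> ineqmult s j 0 = 0 ->
        ((grad_w_ineqc (primal s) p)^T *m d) j 0 <= 0].

Definition SOSC s p : Prop :=
  kkt_point s p /\
  forall d : 'cV[R]_nw, d != 0 -> critical_direction s p d ->
    0 < (d^T *m hess_ww s p *m d) 0 0.

Definition strict_complementarity s p : Prop :=
  forall j, j \in active (primal s) p -> 0 < ineqmult s j 0.

Definition regular_at s p : Prop :=
  [/\ C2_data (primal s) p, LICQ s p, SOSC s p & strict_complementarity s p].

Definition kktM s p
    : 'M[R]_(nw + (nc + #|active (primal s) p|)) :=
  let G := row_mx (grad_w_eqc (primal s) p) (grad_w_act (primal s) p) in
  block_mx (hess_ww s p) G G^T 0.

Definition kktN s p
    : 'M[R]_(nw + (nc + #|active (primal s) p|), nx) :=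
  col_mx (hess_wp s p)
    (col_mx (grad_p_eqc (primal s) p)^T (grad_p_act (primal s) p)^T).

(* A vector indexed by the elements of A, extended by 0 outside A. *)
Definition extend0 (A : {set 'I_ng}) (v : 'cV[R]_#|A|) : 'cV[R]_ng :=
  colsub (@enum_val _ (mem A)) 1%:M *m v.

(* The solution of the tangential system only has multiplier components for
   the active inequality constraints; the multipliers of the inactive ones,
   which vanish at a KKT point, are left unchanged. *)
Definition predictor s p (dp : 'cV[R]_nx) : 'cV[R]_(nw + (nc + ng)) :=
  let ds := - (invmx (kktM s p) *m kktN s p *m dp) in
  s + col_mx (usubmx ds)
        (col_mx (usubmx (dsubmx ds)) (extend0 (dsubmx (dsubmx ds)))).

End ParametricNLP.

(* Region i is attached to the base point pb i; a parameter p is handled by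
   the predictor of the region number reg p it is assigned to. *)
Definition piecewise_manifold (R : realType) (nw nx nc ng Ns : nat)
    (P : pnlp R nw nx nc ng) (sstar : 'cV[R]_nx -> 'cV[R]_(nw + (nc + ng)))
    (pb : 'I_Ns -> 'cV[R]_nx) (reg : 'cV[R]_nx -> 'I_Ns) (p : 'cV[R]_nx)
    : 'cV[R]_(nw + (nc + ng)) :=
  let pi := pb (reg p) in predictor P (sstar pi) pi (p - pi).

(* The terms F i are meant to be nonnegative and Ns to be nonzero, so that the
   default value 0 plays no role. *)
Definition maxval (R : realType) (Ns : nat) (F : 'I_Ns -> R) : R :=
  \big[Num.max/0]_(i < Ns) F i.

Definition is_argmin (R : realType) (T : Type) (F : T -> R) (x : T) : Prop :=
  forall y : T, F x <= F y.

Definition random_vector (d : measure_display) (Omega : measurableType d)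
    (R : realType) (n : nat) (X : Omega -> 'cV[R]_n) : Prop :=
  forall j : 'I_n, measurable_fun [set: Omega] (fun omega => X omega j 0).

(* eps = 0 is allowed. *)
Definition consistent (d : measure_display) (Omega : measurableType d)
    (R : realType) (Pr : probability Omega R) (n : nat)
    (X : nat -> Omega -> 'cV[R]_n) (a : 'cV[R]_n) : Prop :=
  forall eps : R, 0 <= eps ->
    Pr [set omega | eps < enorm (X m omega - a)] @[m --> \oo] --> 0%E.

(* The outer measure Pr^* coincides with Pr on measurable events; it is used
   because no measurability in theta is available for the event. *)
Definition bounded_in_probability (d : measure_display)
    (Omega : measurableType d) (R : realType) (Pr : probability Omega R)
    (n : nat) (X : nat -> Omega -> 'cV[R]_n) (D : R) : Prop :=
  (Pr ^*)%mu [set omega | D < enorm (X m omega)] @[m --> \oo] --> 0%E.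

(* Main.v *)
Require Import Defs.
From HB Require Import structures.
From mathcomp Require Import all_boot all_order all_algebra.
From mathcomp Require Import all_classical all_reals all_analysis.
From mathcomp Require Import measurable_realfun.
Import Order.TTheory GRing.Theory Num.Theory.
Import numFieldNormedType.Exports.
Local Open Scope classical_set_scope.
Local Open Scope ring_scope.

(** The policy equals the exact manifold s*, which lies within D of the
    piecewise linear manifold, and the latter is [pi] at the parameter thetahat.
    Hence the error can exceed D only at outcomes where the estimator differs
    from thetahat.  Consistency holds for every eps >= 0, and at eps = 0 it says
    that the probability of missing thetahat tends to 0, which gives
    the bound whatever the dependence of [pi] on its parameter.  The error event
    lies inside the measurable event where thetahat is missed, and monotonicity
    of the outer measure concludes ([bounded_in_probability_consistent]). *)

Lemma enormN (R : realType) (n : nat) (x : 'cV[R]_n) : enorm (- x) = enorm x.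
Proof. by rewrite /enorm; under eq_bigr do rewrite mxE sqrrN. Qed.

Lemma enorm_gt0 (R : realType) (n : nat) (x : 'cV[R]_n) :
  x != 0 -> 0 < enorm x.
Proof.
move=> x0; rewrite /enorm sqrtr_gt0 lt0r sumr_ge0 ?andbT; last first.
  by move=> i _; rewrite sqr_ge0.
apply: contra x0 => /eqP s0; apply/eqP/colP => i; rewrite mxE.
apply/eqP; rewrite -sqrf_eq0; apply/eqP.
by apply: (psumr_eq0P _ s0) => // j _; rewrite sqr_ge0.
Qed.

Lemma measurable_enormB (d : measure_display) (Omega : measurableType d)
    (R : realType) (n : nat) (X : Omega -> 'cV[R]_n) (a : 'cV[R]_n) :
  random_vector X -> measurable_fun setT (fun omega => enorm (X omega - a)).
Proof.
move=> mX; rewrite /enorm.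
apply: (measurableT_comp (continuous_measurable_fun (@sqrt_continuous R))).
apply: measurable_sum => i.
apply: measurable_funX.
under eq_fun do rewrite !mxE.
by apply: measurable_funB => //; exact: mX.
Qed.

(** Consistency with eps = 0 makes any property of the limit parameter hold for
    the estimator with probability tending to 1.  The error event need not be
    measurable, but it is contained in the event that the estimator misses its
    limit; the latter is measurable, so that its outer measure is its
    probability. *)
Lemma bounded_in_probability_consistent (d : measure_display)
    (Omega : measurableType d) (R : realType) (Pr : probability Omega R)
    (n m : nat) (X : nat -> Omega -> 'cV[R]_n) (a : 'cV[R]_n)
    (f : 'cV[R]_n -> 'cV[R]_m) (D : R) :
  (forall k, random_vector (X k)) -> consistent Pr X a -> enorm (f a) <= D ->
  bounded_in_probability Pr (fun k omega => f (X k omega)) D.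
Proof.
move=> mX cX fa; rewrite /bounded_in_probability.
apply: (squeeze_cvge _ (cvg_cst 0%E) (cX 0 (lexx 0))).
apply: nearW => k; apply/andP; split; first exact: outer_measure_ge0.
have mA : measurable [set omega | 0 < enorm (X k omega - a)].
  rewrite -[X in measurable X]setTI.
  have -> : [set omega | 0 < enorm (X k omega - a)] =
      (fun omega => enorm (X k omega - a)) @^-1` `]0, +oo[%classic.
    by apply/seteqP; split=> omega /=; rewrite in_itv/= andbT.
  by apply: measurable_enormB => //; exact: mX.
rewrite -(measurable_mu_extE Pr mA).
apply: le_outer_measure => omega /= ltD.
rewrite enorm_gt0 // subr_eq0; apply: contraTN ltD => /eqP ->.
by rewrite -leNgt.
Qed.

Theorem corollary1 (R : realType) (nw nx nc ng ntheta Ns : nat)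
  (P : pnlp R nw nx nc ng)
  (* exact solution manifold and MPC policy *)
  (sstar : 'cV[R]_nx -> 'cV[R]_(nw + (nc + ng)))
  (sstar_opt : forall p, feasible_params P p -> optimal_solution P (sstar p) p)
  (pi_mpc : 'cV[R]_nx -> 'cV[R]_(nw + (nc + ng)))
  (pi_mpcE : forall p, feasible_params P p -> pi_mpc p = sstar p)
  (* base points, regions and their sizes *)
  (Ns_gt0 : (0 < Ns)%N)
  (pb : 'I_Ns -> 'cV[R]_nx)
  (pb_feas : forall i, feasible_params P (pb i))
  (pb_regular : forall i, regular_at P (sstar (pb i)) (pb i))
  (region : 'I_Ns -> set 'cV[R]_nx)
  (region_feas : forall i, region i `<=` feasible_params P)
  (region_pb : forall i, region i (pb i))
  (delta : 'I_Ns -> R)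
  (delta_gt0 : forall i, 0 < delta i)
  (region_size : forall i p, region i p -> enorm (p - pb i) <= delta i)
  (region_active : forall i p, region i p ->
    active P (primal (sstar p)) p = active P (primal (sstar (pb i))) (pb i))
  (reg : 'cV[R]_nx -> 'I_Ns)
  (reg_cover : forall p, feasible_params P p -> region (reg p) p)
  (* error bound for the piecewise linear manifold *)
  (L : 'I_Ns -> R)
  (L_gt0 : forall i, 0 < L i)
  (shat_bound : forall p, feasible_params P p ->
    enorm (piecewise_manifold P sstar pb reg p - sstar p)
      <= maxval (fun i => L i * delta i ^+ 2))
  (* sufficiently rich parametric function *)
  (pi : 'cV[R]_nx -> 'cV[R]_ntheta -> 'cV[R]_(nw + (nc + ng)))
  (thetastar thetahat : 'cV[R]_ntheta)
  (pi_star : forall p, feasible_params P p -> sstar p = pi p thetastar)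
  (pi_hat : forall p, feasible_params P p ->
    piecewise_manifold P sstar pb reg p = pi p thetahat)
  (* M = Ns * Np random training points and the resulting estimator *)
  (d : measure_display) (Omega : measurableType d) (Pr : probability Omega R)
  (sample : forall Np : nat, 'I_(Ns * Np) -> Omega -> 'cV[R]_nx)
  (sample_rv : forall Np k, random_vector (sample Np k))
  (sample_feas : forall Np k omega, feasible_params P (sample Np k omega))
  (theta2 : nat -> Omega -> 'cV[R]_ntheta)
  (theta2_rv : forall Np, random_vector (theta2 Np))
  (theta2_argmin : forall Np omega,
    is_argmin (fun theta : 'cV[R]_ntheta =>
      \sum_(k < Ns * Np)
        enorm (pi (sample Np k omega) theta
               - piecewise_manifold P sstar pb reg (sample Np k omega)) ^+ 2)
      (theta2 Np omega))
  (theta2_consistent : consistent Pr theta2 thetahat) :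
  forall p, feasible_params P p ->
    bounded_in_probability Pr
      (fun Np omega => pi_mpc p - pi p (theta2 Np omega))
      (maxval (fun i => L i * delta i ^+ 2)).
Proof.
move=> p pF.
apply: (bounded_in_probability_consistent _ _ _ _ _ _ _ thetahat
  (fun theta => pi_mpc p - pi p theta) _ theta2_rv theta2_consistent).
by rewrite -pi_hat // pi_mpcE // -enormN opprB shat_bound.
Qed.
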